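(* Let $\mathbb{F}=\mathbb{R}$ or $\mathbb{F}=\mathbb{C}$. If $T\in S^d(\mathbb{F}^2)$ is symmetric and $P\subseteq\{1,\dots,d\}$ is non-empty, then the optimal $P$-partially orthogonal rank-$2$ approximation of $T$ can be chosen to have terms that are symmetric in each of the two disjoint index sets $P$ and $\{1,\dots,d\}\setminus P$, i.e. $$\max_Y\{|\langle T,Y\rangle| : Y\in\mathcal{PCON}_{2,P},\ \|Y\|\le1\}=\max\Big\{\Big|\Big\langle T,\sum_{k=1}^2\sigma_k\,w_k^{\otimes|P|}\otimes v_k^{\otimes(d-|P|)}\Big\rangle\Big| : \langle w_k,w_{k'}\rangle=\delta_{k,k'},\ \|v_k\|=1,\ \sum_{k=1}^2|\sigma_k|^2=1\Big\},$$ where the maximum on the right is over $w_1,w_2,v_1,v_2\in\mathbb{F}^2$ and $\sigma_1,\sigma_2\in\mathbb{F}$.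
   Context: Tensors in $\mathbb{F}^{n_1\times\cdots\times n_d}$ carry the inner product $\langle T,S\rangle=\sum_{i_1,\dots,i_d}T(i_1,\dots,i_d)\overline{S(i_1,\dots,i_d)}$ and norm $\|T\|=\sqrt{\langle T,T\rangle}$. The tensor $v_1\otimes\cdots\otimes v_d$ has entries $\prod_j v_j(i_j)$, and $v^{\otimes m}$ is the $m$-fold tensor power. $\delta_{k,k'}$ is the Kronecker delta. $S^d(\mathbb{F}^n)$ denotes the tensors in $\mathbb{F}^{n\times\cdots\times n}$ ($d$ factors) invariant under all permutations of the $d$ indices. For non-empty $P\subseteq\{1,\dots,d\}$, two tensors $x_1\otimes\cdots\otimes x_d$ and $y_1\otimes\cdots\otimes y_d$ are $P$-partially orthogonal if $\langle x_j,y_j\rangle=0$ for each $j\in P$. $\mathcal{PCON}_{r,P}$ is the set of all tensors of the form $\sum_{k=1}^r\sigma_k\,v_{k1}\otimes\cdots\otimes v_{kd}$ with $\sigma_k\in\mathbb{F}$ (zero coefficients or zero vectors allowed) whose terms are pairwise $P$-partially orthogonal. Since $T$ is symmetric, permuting tensor dimensions of $Y$ does not change $\langle T,Y\rangle$, so $P$ is identified with $\{1,\dots,|P|\}$; this is why the right-hand side places the $P$-factors in the first $|P|$ positions. *)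

(* Defs.v *)
From HB Require Import structures.
From mathcomp Require Import all_boot all_order all_algebra all_fingroup.
From mathcomp Require Import classical_sets reals.
From mathcomp.real_closed Require Import complex.

Set Implicit Arguments.
Unset Strict Implicit.
Unset Printing Implicit Defensive.

Import Order.TTheory GRing.Theory Num.Theory.
Local Open Scope ring_scope.
Local Open Scope complex_scope.
Local Open Scope classical_set_scope.

Variant base_field := Reals | Complexes.

Definition scalar (R : realType) (K : base_field) : numFieldType :=
  match K with Reals => R : numFieldType | Complexes => R[i] : numFieldType end.

Definition conjugate (R : realType) (K : base_field) :
    scalar R K -> scalar R K :=
  match K return scalar R K -> scalar R K with
  | Reals => fun x : R => x
  | Complexes => fun z : R[i] => conjc z
  end.

Definition real_part (R : realType) (K : base_field) : scalar R K -> R :=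
  match K return scalar R K -> R with
  | Reals => fun x : R => x
  | Complexes => fun z : R[i] => complex.Re z
  end.

(* The library norm `|x| takes its (real, nonnegative) value in the field
   [scalar R K] itself; [real_part] only brings it back to R. *)
Definition modulus (R : realType) (K : base_field) (x : scalar R K) : R :=
  real_part `|x|.

(* Used both for vectors (I := 'I_n) and for tensors
   (I := {ffun 'I_d -> 'I_n}, the multi-indices). *)
Definition inner (R : realType) (K : base_field) (I : finType)
    (x y : {ffun I -> scalar R K}) : scalar R K :=
  \sum_(i : I) x i * conjugate (y i).

Definition norm (R : realType) (K : base_field) (I : finType)
    (x : {ffun I -> scalar R K}) : R :=
  Num.sqrt (real_part (inner x x)).

Definition vec (R : realType) (K : base_field) (n : nat) :=
  {ffun 'I_n -> scalar R K}.

Definition tensor (R : realType) (K : base_field) (d n : nat) :=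
  {ffun {ffun 'I_d -> 'I_n} -> scalar R K}.

Definition rank_one (R : realType) (K : base_field) (d n : nat)
    (v : 'I_d -> vec R K n) : tensor R K d n :=
  [ffun i : {ffun 'I_d -> 'I_n} => \prod_(j < d) v j (i j)].

(* $w^{\otimes p} \otimes v^{\otimes (d - p)}$, for p <= d *)
Definition two_powers (R : realType) (K : base_field) (d n p : nat)
    (w v : vec R K n) : tensor R K d n :=
  rank_one (fun j : 'I_d => if (j < p)%N then w else v).

Definition combination (R : realType) (K : base_field) (d n r : nat)
    (sigma : 'I_r -> scalar R K) (x : 'I_r -> tensor R K d n) :
    tensor R K d n :=
  [ffun i : {ffun 'I_d -> 'I_n} => (\sum_(k < r) sigma k * x k i : scalar R K)].

Definition symmetric_tensor (R : realType) (K : base_field) (d n : nat)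
    (T : tensor R K d n) : Prop :=
  forall (s : 'S_d) (i : {ffun 'I_d -> 'I_n}), T [ffun j => i (s j)] = T i.

(* A property of the factor families: x and y stand for
   $x_1\otimes\cdots\otimes x_d$ and $y_1\otimes\cdots\otimes y_d$. *)
Definition partially_orthogonal (R : realType) (K : base_field) (d n : nat)
    (P : {set 'I_d}) (x y : 'I_d -> vec R K n) : Prop :=
  forall j : 'I_d, j \in P -> inner (x j) (y j) = 0.

Definition PCON (R : realType) (K : base_field) (d n r : nat)
    (P : {set 'I_d}) : set (tensor R K d n) :=
  [set Y : tensor R K d n | exists (sigma : 'I_r -> scalar R K) (v : 'I_r -> 'I_d -> vec R K n),
     (forall k k' : 'I_r, k != k' -> partially_orthogonal P (v k) (v k')) /\
     Y = combination sigma (fun k => rank_one (v k))].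

Definition is_max (R : realType) (A : set R) (m : R) : Prop :=
  A m /\ ubound A m.

Definition PCON_values (R : realType) (K : base_field) (d n r : nat)
    (P : {set 'I_d}) (T : tensor R K d n) : set R :=
  [set modulus (inner T Y) | Y in [set Y : tensor R K d n | PCON r P Y /\ norm Y <= 1]].

Definition symmetric_values (R : realType) (K : base_field) (d n r : nat)
    (P : {set 'I_d}) (T : tensor R K d n) : set R :=
  [set x | exists (w v : 'I_r -> vec R K n) (sigma : 'I_r -> scalar R K),
     [/\ forall k k' : 'I_r, inner (w k) (w k') = (k == k')%:R,
         forall k : 'I_r, norm (v k) = 1,
         \sum_(k < r) modulus (sigma k) ^+ 2 = 1 &
         x = modulus (inner T (combination sigma
                           (fun k => two_powers d #|P| (w k) (v k))))]].

(* Main.v *)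
(* The terms of a competitor are, up to coefficients, unit rank one tensors [x]
   and [x'], orthogonal in some factor, so [|<T, Y>|^2] is at most
   [|<T, x>|^2 + |<T, x'>|^2]. In the plane, orthogonality in the factors of [P]
   forces [x' j = perp (x j)], where [perp (a, b) = (- b^*, a^* )]. Banach's theorem
   (the norm of a symmetric multilinear form is attained on the diagonal) makes
   the factors outside [P] equal within each term. Since [perp] is conjugate
   linear, the pair of the first value and the conjugate of the second one is a
   vector-valued symmetric multilinear form in the remaining [x j], and Banach's
   theorem for its product with a fixed vector makes these equal as well. *)
From HB Require Import structures.
From mathcomp Require Import all_boot all_order all_algebra all_fingroup.
From mathcomp Require Import classical_sets reals.
From mathcomp.real_closed Require Import complex.
From mathcomp Require Import boolp ring lra.
From mathcomp Require Import topology normedtype derive.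
(* Last, since ssralg also has a notation [scalar]. *)
Require Import Defs.

Set Implicit Arguments.
Unset Strict Implicit.
Unset Printing Implicit Defensive.

Import Order.TTheory GRing.Theory Num.Theory numFieldNormedType.Exports.
Local Open Scope ring_scope.

(** * Arithmetic common to the real and complex scalars *)

Section Scalars.
Context (R : realType) (K : base_field).
Local Notation F := (scalar R K).
Implicit Types (x y : F) (a b : R).

Definition of_real : R -> F :=
  match K return R -> scalar R K with
  | Reals => fun a => a
  | Complexes => fun a => (a%:C)%C
  end.

(** The value 0 over the reals lets both fields share one formula for products and for moduli. *)
Definition imag_part : F -> R :=
  match K return scalar R K -> R with
  | Reals => fun _ => 0
  | Complexes => fun z => complex.Im z
  end.

Lemma conjugateB : {morph (@conjugate R K) : x y / x - y}.
Proof. by rewrite /conjugate; case: K => //= x y; rewrite rmorphB. Qed.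

HB.instance Definition _ :=
  GRing.isZmodMorphism.Build F F (@conjugate R K) conjugateB.

Lemma conjugate_monoid : monoid_morphism (@conjugate R K).
Proof.
rewrite /conjugate; case: K => //.
by split=> [|x y]; rewrite ?rmorph1 ?rmorphM.
Qed.

HB.instance Definition _ :=
  GRing.isMonoidMorphism.Build F F (@conjugate R K) conjugate_monoid.

Lemma of_realB : {morph of_real : a b / a - b}.
Proof. by rewrite /of_real; case: K => //= a b; rewrite rmorphB. Qed.

HB.instance Definition _ := GRing.isZmodMorphism.Build R F of_real of_realB.

Lemma of_real_monoid : monoid_morphism of_real.
Proof.
rewrite /of_real; case: K => //.
by split=> [|a b]; rewrite ?rmorph1 ?rmorphM.
Qed.

HB.instance Definition _ :=
  GRing.isMonoidMorphism.Build R F of_real of_real_monoid.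

Lemma real_partB : {morph (@real_part R K) : x y / x - y}.
Proof. by rewrite /real_part; case: K => //= -[a b] [c e]. Qed.

HB.instance Definition _ :=
  GRing.isZmodMorphism.Build F R (@real_part R K) real_partB.

Lemma imag_partB : {morph imag_part : x y / x - y}.
Proof.
by rewrite /imag_part; case: K => /= [x y|[a b] [c e]] //; rewrite subr0.
Qed.

HB.instance Definition _ :=
  GRing.isZmodMorphism.Build F R imag_part imag_partB.

Lemma conjugateK : involutive (@conjugate R K).
Proof. by rewrite /conjugate; case: K => //= x; rewrite conjcK. Qed.

Lemma conjugate_of_real a : conjugate (of_real a) = of_real a.
Proof. by rewrite /conjugate /of_real; case: K => //; exact: conjc_real. Qed.

Lemma of_realK : cancel of_real (@real_part R K).
Proof. by rewrite /real_part /of_real; case: K. Qed.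

Lemma real_part_conjugate x : real_part (conjugate x) = real_part x.
Proof. by move: x; rewrite /real_part /conjugate; case: K => //= -[]. Qed.

Lemma imag_part_conjugate x : imag_part (conjugate x) = - imag_part x.
Proof.
by move: x; rewrite /imag_part /conjugate; case: K => //= x; rewrite ?oppr0 //; case: x.
Qed.

Lemma real_partM x y :
  real_part (x * y) = real_part x * real_part y - imag_part x * imag_part y.
Proof.
move: x y; rewrite /real_part /imag_part; case: K => [x y|[a b] [c e]] //=.
by rewrite mul0r subr0.
Qed.

Lemma imag_partM x y :
  imag_part (x * y) = real_part x * imag_part y + imag_part x * real_part y.
Proof.
move: x y; rewrite /real_part /imag_part; case: K => [x y|[a b] [c e]] //=.
by rewrite mul0r mulr0 addr0.
Qed.

Lemma real_partZ a x : real_part (of_real a * x) = a * real_part x.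
Proof.
move: x; rewrite /real_part /of_real; case: K => [x|[b c]] //=.
by rewrite mul0r subr0.
Qed.

Lemma scalar_ext x y :
  real_part x = real_part y -> imag_part x = imag_part y -> x = y.
Proof.
move: x y; rewrite /real_part /imag_part; case: K => [x y|[a b] [c e]] //=.
by move=> -> ->.
Qed.

Lemma sqr_modulus x : modulus x ^+ 2 = real_part x ^+ 2 + imag_part x ^+ 2.
Proof.
move: x; rewrite /modulus /real_part /imag_part; case: K => [x|[a b]] /=.
  by rewrite real_normK ?num_real // expr0n addr0.
by rewrite sqr_sqrtr // addr_ge0 // sqr_ge0.
Qed.

Lemma mul_conjugate x : x * conjugate x = of_real (modulus x ^+ 2).
Proof.
rewrite sqr_modulus; move: x.
rewrite /conjugate /of_real /real_part /imag_part; case: K => [x|[a b]] /=.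
  by rewrite expr0n addr0 expr2.
by apply/eqP; rewrite eq_complex /=; apply/andP; split; apply/eqP; ring.
Qed.

Lemma modulus_ge0 x : 0 <= modulus x.
Proof.
by move: x; rewrite /modulus /real_part; case: K => [x|[a b]] /=; rewrite ?sqrtr_ge0.
Qed.

Lemma modulusM x y : modulus (x * y) = modulus x * modulus y.
Proof.
rewrite /modulus normrM; move: x y; rewrite /real_part; case: K => //= x y.
by rewrite mul0r subr0.
Qed.

Lemma modulusN x : modulus (- x) = modulus x.
Proof. by rewrite /modulus normrN. Qed.

Lemma modulus0 : modulus (0 : F) = 0.
Proof. by rewrite /modulus normr0 raddf0. Qed.

Lemma modulus_eq0 x : modulus x = 0 -> x = 0.
Proof.
move=> x0; have := sqr_modulus x; rewrite x0 expr0n /= => /esym/eqP.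
rewrite paddr_eq0 ?sqr_ge0 // !sqrf_eq0 => /andP[/eqP re0 /eqP im0].
by apply: scalar_ext; rewrite ?re0 ?im0 ?raddf0.
Qed.

Lemma sqr_modulus_of_real a : modulus (of_real a) ^+ 2 = a ^+ 2.
Proof.
apply: (can_inj of_realK).
by rewrite -mul_conjugate conjugate_of_real -rmorphM.
Qed.

Lemma modulus_of_real a : 0 <= a -> modulus (of_real a) = a.
Proof.
move=> a0; apply/eqP; rewrite -(@eqrXn2 _ 2) ?modulus_ge0 //.
by rewrite sqr_modulus_of_real.
Qed.

Lemma modulus_conjugate x : modulus (conjugate x) = modulus x.
Proof.
apply/eqP; rewrite -(@eqrXn2 _ 2) ?modulus_ge0 //.
by rewrite !sqr_modulus real_part_conjugate imag_part_conjugate sqrrN.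
Qed.

Lemma of_real_unit a : a != 0 -> of_real a * of_real a^-1 = 1.
Proof. by move=> a0; rewrite -rmorphM mulfV // rmorph1. Qed.

End Scalars.

(** * Inner products: Bessel, Cauchy-Schwarz and extremal functionals *)

Section InnerProduct.
Context (R : realType) (K : base_field) (I : finType).
Local Notation F := (scalar R K).
Implicit Types (x y z : {ffun I -> F}) (a : F).

Definition scalev a x : {ffun I -> F} := [ffun i => a * x i].

Definition sqnorm x : R := real_part (inner x x).

Lemma innerDl x y z : inner (x + y) z = inner x z + inner y z.
Proof.
by rewrite /inner -big_split; apply: eq_bigr => i _; rewrite ffunE mulrDl.
Qed.

Lemma innerZl a x y : inner (scalev a x) y = a * inner x y.
Proof.
by rewrite /inner mulr_sumr; apply: eq_bigr => i _; rewrite ffunE mulrA.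
Qed.

Lemma inner_conjugate x y : inner y x = conjugate (inner x y).
Proof.
rewrite /inner rmorph_sum; apply: eq_bigr => i _.
by rewrite rmorphM /= conjugateK mulrC.
Qed.

Lemma innerDr x y z : inner x (y + z) = inner x y + inner x z.
Proof. by rewrite inner_conjugate innerDl rmorphD /= -!inner_conjugate. Qed.

Lemma innerZr a x y : inner x (scalev a y) = conjugate a * inner x y.
Proof. by rewrite inner_conjugate innerZl rmorphM /= -!inner_conjugate. Qed.

Lemma scalevN1 x : scalev (-1) x = - x.
Proof. by apply/ffunP => i; rewrite !ffunE mulN1r. Qed.

Lemma scalev1 x : scalev 1 x = x.
Proof. by apply/ffunP => i; rewrite !ffunE mul1r. Qed.

Lemma scalev0 x : scalev 0 x = 0.
Proof. by apply/ffunP => i; rewrite !ffunE mul0r. Qed.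

Lemma scalevA a b x : scalev a (scalev b x) = scalev (a * b) x.
Proof. by apply/ffunP => i; rewrite !ffunE mulrA. Qed.

Lemma innerNl x y : inner (- x) y = - inner x y.
Proof. by rewrite -scalevN1 innerZl mulN1r. Qed.

Lemma innerNr x y : inner x (- y) = - inner x y.
Proof. by rewrite -scalevN1 innerZr rmorphN1 mulN1r. Qed.

Lemma inner0l y : inner 0 y = 0.
Proof. by rewrite -(scalev0 y) innerZl mul0r. Qed.

Lemma inner0r y : inner y 0 = 0.
Proof. by rewrite inner_conjugate inner0l rmorph0. Qed.

Lemma sqnormE x : sqnorm x = \sum_i modulus (x i) ^+ 2.
Proof.
rewrite /sqnorm /inner raddf_sum; apply: eq_bigr => i _.
by rewrite mul_conjugate /= of_realK.
Qed.

Lemma inner_self x : inner x x = of_real K (sqnorm x).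
Proof.
rewrite sqnormE rmorph_sum; apply: eq_bigr => i _.
by rewrite mul_conjugate.
Qed.

Lemma sqnorm_ge0 x : 0 <= sqnorm x.
Proof. by rewrite sqnormE sumr_ge0 // => i _; rewrite sqr_ge0. Qed.

Lemma sqnorm_eq0 x : sqnorm x = 0 -> x = 0.
Proof.
rewrite sqnormE => /eqP; rewrite psumr_eq0; last by move=> i _; rewrite sqr_ge0.
move=> /allP x0; apply/ffunP => i; rewrite ffunE; apply: modulus_eq0.
by have := x0 i (mem_index_enum i); rewrite sqrf_eq0 => /eqP.
Qed.

Lemma sqnorm0 : sqnorm 0 = 0.
Proof. by rewrite /sqnorm inner0l raddf0. Qed.

Lemma sqnormN x : sqnorm (- x) = sqnorm x.
Proof. by rewrite /sqnorm innerNl innerNr opprK. Qed.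

Lemma sqnormZ a x : sqnorm (scalev a x) = modulus a ^+ 2 * sqnorm x.
Proof.
by rewrite /sqnorm innerZl innerZr mulrA mul_conjugate real_partZ.
Qed.

Lemma sqnormD x y :
  sqnorm (x + y) = sqnorm x + sqnorm y + 2 * real_part (inner x y).
Proof.
rewrite /sqnorm innerDl !innerDr !raddfD /= (inner_conjugate x y).
by rewrite real_part_conjugate; ring.
Qed.

Lemma norm_eq1 x : norm x = 1 <-> sqnorm x = 1.
Proof.
rewrite /norm -/(sqnorm x); split=> [n1|->]; last exact: sqrtr1.
by rewrite -(sqr_sqrtr (sqnorm_ge0 x)) n1 expr1n.
Qed.

Lemma norm_le1 x : norm x <= 1 <-> sqnorm x <= 1.
Proof. by rewrite /norm -/(sqnorm x) -{1}sqrtr1 ler_sqrt. Qed.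

(** Pythagoras for the projection on the line of [y]. Bessel's inequality is the nonnegativity of
    the left side, and its equality case is the vanishing of the residual. *)
Lemma sqnorm_residual x y : sqnorm y = 1 ->
  sqnorm (x - scalev (inner x y) y) = sqnorm x - modulus (inner x y) ^+ 2.
Proof.
move=> y1; rewrite sqnormD sqnormN sqnormZ y1 innerNr innerZr raddfN /=.
by rewrite [conjugate _ * _]mulrC mul_conjugate of_realK; ring.
Qed.

Lemma bessel x y : sqnorm y = 1 -> modulus (inner x y) ^+ 2 <= sqnorm x.
Proof. by move=> y1; rewrite -subr_ge0 -sqnorm_residual // sqnorm_ge0. Qed.

Lemma bessel_eq x y : sqnorm y = 1 ->
  sqnorm x <= modulus (inner x y) ^+ 2 -> x = scalev (inner x y) y.
Proof.
move=> y1 le; apply/eqP; rewrite -subr_eq0; apply/eqP/sqnorm_eq0.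
by apply/le_anti; rewrite sqnorm_ge0 sqnorm_residual // subr_le0 le.
Qed.

Lemma normalize x : x != 0 ->
  exists t u, [/\ 0 < t, t ^+ 2 = sqnorm x, sqnorm u = 1 &
                x = scalev (of_real K t) u].
Proof.
move=> x0; have nx : 0 < sqnorm x.
  rewrite lt_def sqnorm_ge0 andbT; apply: contraNneq x0 => /sqnorm_eq0 ->.
  exact: eqxx.
have t0 : 0 < Num.sqrt (sqnorm x) by rewrite sqrtr_gt0.
exists (Num.sqrt (sqnorm x)), (scalev (of_real K (Num.sqrt (sqnorm x))^-1) x).
rewrite sqr_sqrtr ?ltW //; split=> //.
  by rewrite sqnormZ sqr_modulus_of_real exprVn sqr_sqrtr ?ltW // mulVf ?gt_eqF.
by rewrite scalevA of_real_unit ?gt_eqF // scalev1.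
Qed.

Lemma cauchy_schwarz x y : modulus (inner x y) ^+ 2 <= sqnorm x * sqnorm y.
Proof.
have [->|/normalize[t [u [t0 <- u1 ->]]]] := eqVneq y 0.
  by rewrite inner0r modulus0 expr0n mulr_ge0 ?sqnorm_ge0.
rewrite innerZr modulusM modulus_conjugate exprMn sqr_modulus_of_real mulrC.
by rewrite ler_wpM2r ?sqr_ge0 ?bessel.
Qed.

(** Testing maximality on the direction of [l] itself shows that the value at [y] is at least the
    norm of [l], so [y] is in the equality case of Bessel's inequality. *)
Lemma extremal_functional (l y : {ffun I -> F}) : sqnorm y = 1 ->
    (forall u, sqnorm u = 1 -> modulus (inner l u) <= modulus (inner l y)) ->
  l = scalev (inner l y) y.
Proof.
move=> y1 ymax; apply: bessel_eq => //.
have [->|/normalize[t [u [t0 tl u1 lE]]]] := eqVneq l 0.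
  by rewrite sqnorm0 sqr_ge0.
have := ymax u u1; rewrite [in inner l u]lE innerZl inner_self u1 rmorph1 mulr1.
rewrite (modulus_of_real _ (ltW t0)) -tl => le.
by rewrite ler_sqr ?nnegrE ?modulus_ge0 // ltW.
Qed.

End InnerProduct.

(** * Continuity of scalar-valued functions *)

Section Continuity.
Context (R : realType) (K : base_field) (D : topologicalType).
Local Notation F := (scalar R K).
Implicit Types f g : D -> F.

(* [scalar R K] carries no topology for an abstract [K], hence the detour
   through real and imaginary parts. *)
Definition scalar_continuous f :=
  continuous (fun x => real_part (f x)) /\
  continuous (fun x => imag_part (f x)).

Lemma scalar_continuous_cst (a : F) : scalar_continuous (fun=> a).
Proof. by split; apply: cst_continuous. Qed.

Lemma scalar_continuousD f g : scalar_continuous f -> scalar_continuous g ->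
  scalar_continuous (fun x => f x + g x).
Proof.
move=> [fr fi] [gr gi]; split.
  under eq_fun do rewrite raddfD.
  by move=> x; apply: cvgD; [exact: fr | exact: gr].
under eq_fun do rewrite raddfD.
by move=> x; apply: cvgD; [exact: fi | exact: gi].
Qed.

Lemma scalar_continuousM f g : scalar_continuous f -> scalar_continuous g ->
  scalar_continuous (fun x => f x * g x).
Proof.
move=> [fr fi] [gr gi]; split.
  under eq_fun do rewrite real_partM.
  by move=> x; apply: cvgB; apply: cvgM; [exact: fr|exact: gr|exact: fi|exact: gi].
under eq_fun do rewrite imag_partM.
by move=> x; apply: cvgD; apply: cvgM; [exact: fr|exact: gi|exact: fi|exact: gr].
Qed.

Lemma scalar_continuous_conjugate f : scalar_continuous f ->
  scalar_continuous (fun x => conjugate (f x)).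
Proof.
move=> [fr fi]; split.
  by under eq_fun do rewrite real_part_conjugate.
under eq_fun do rewrite imag_part_conjugate.
by move=> x; apply: cvgN; exact: fi.
Qed.

Lemma scalar_continuousN f : scalar_continuous f ->
  scalar_continuous (fun x => - f x).
Proof.
move=> cf; rewrite (_ : (fun x => - f x) = (fun x => -1 * f x)).
  by apply: scalar_continuousM => //; exact: scalar_continuous_cst.
by apply/funext => x; rewrite mulN1r.
Qed.

Lemma scalar_continuous_sum (J : Type) (s : seq J) (P : pred J) (f : J -> D -> F) :
  (forall j, P j -> scalar_continuous (f j)) ->
  scalar_continuous (fun x => \sum_(j <- s | P j) f j x).
Proof.
move=> cf; elim: s => [|j s IH].
  rewrite (_ : (fun x => _) = (fun=> 0)); first exact: scalar_continuous_cst.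
  by apply/funext => x; rewrite big_nil.
case Pj: (P j); last first.
  by rewrite (_ : (fun x => _) = (fun x => \sum_(j <- s | P j) f j x)) //;
     apply/funext => x; rewrite big_cons Pj.
rewrite (_ : (fun x => _) = (fun x => f j x + \sum_(j <- s | P j) f j x));
  last by apply/funext => x; rewrite big_cons Pj.
by apply: scalar_continuousD => //; exact: cf.
Qed.

Lemma scalar_continuous_prod (J : Type) (s : seq J) (P : pred J) (f : J -> D -> F) :
  (forall j, P j -> scalar_continuous (f j)) ->
  scalar_continuous (fun x => \prod_(j <- s | P j) f j x).
Proof.
move=> cf; elim: s => [|j s IH].
  rewrite (_ : (fun x => _) = (fun=> 1)); first exact: scalar_continuous_cst.
  by apply/funext => x; rewrite big_nil.
case Pj: (P j); last first.
  by rewrite (_ : (fun x => _) = (fun x => \prod_(j <- s | P j) f j x)) //;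
     apply/funext => x; rewrite big_cons Pj.
rewrite (_ : (fun x => _) = (fun x => f j x * \prod_(j <- s | P j) f j x));
  last by apply/funext => x; rewrite big_cons Pj.
by apply: scalar_continuousM => //; exact: cf.
Qed.

Lemma scalar_continuous_inner (I : finType) (u v : D -> {ffun I -> F}) :
  (forall i, scalar_continuous (fun x => u x i)) ->
  (forall i, scalar_continuous (fun x => v x i)) ->
  scalar_continuous (fun x => inner (u x) (v x)).
Proof.
move=> cu cv; apply: scalar_continuous_sum => i _.
by apply: scalar_continuousM => //; apply: scalar_continuous_conjugate.
Qed.

Lemma continuous_sqr_modulus f : scalar_continuous f ->
  continuous (fun x => modulus (f x) ^+ 2).
Proof.
move=> [fr fi]; under eq_fun do rewrite sqr_modulus !expr2.
by move=> x; apply: cvgD; apply: cvgM; [exact: fr|exact: fr|exact: fi|exact: fi].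
Qed.

Lemma continuous_sqnorm (I : finType) (u : D -> {ffun I -> F}) :
  (forall i, scalar_continuous (fun x => u x i)) ->
  continuous (fun x => sqnorm (u x)).
Proof. by move=> cu; case: (scalar_continuous_inner cu cu). Qed.

(** The squared modulus has the same zeros and is a continuous real function. *)
Lemma closed_zero f : scalar_continuous f -> closed [set x | f x = 0]%classic.
Proof.
move=> /continuous_sqr_modulus cf.
rewrite (_ : mkset _ = (fun x => modulus (f x) ^+ 2) @^-1` [set 0 : R])%classic.
  by apply: preimage_closed; [move=> x _; exact: cf | exact: closed_eq].
apply/seteqP; split=> x /= => [->|/eqP]; first by rewrite modulus0 expr0n.
by rewrite sqrf_eq0 => /eqP/modulus_eq0.
Qed.

End Continuity.

(** * Extreme values under equational constraints *)

Section ExtremeValue.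
Context (R : realType) (K : base_field) (I : finType).
Local Notation F := (scalar R K).
Local Notation V := {ffun I -> F}.

(* The coordinates [(i, false)] and [(i, true)] hold the real and imaginary
   parts of entry [i]. *)
Definition coordinates : topologicalType := prod_topology (fun _ : I * bool => R).

(** With the value 0 over the reals, [of_coordinates] ignores the imaginary coordinates; it is then
    no longer injective, but surjectivity is all that is required. *)
Definition imag_unit : F :=
  match K return scalar R K with Reals => 0 | Complexes => ('i%C : R[i]) end.

Definition of_coordinates (c : coordinates) : V :=
  [ffun i => of_real K (c (i, false)) + of_real K (c (i, true)) * imag_unit].

(** The bound concerns one chosen preimage: over the reals, the ignored coordinates of an arbitrary
    preimage can be as large as desired. *)
Lemma of_coordinates_surj (x : V) : exists2 c, of_coordinates c = x &
  forall k, `|c k| <= \sum_i modulus (x i).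
Proof.
exists (fun k => if k.2 then imag_part (x k.1) else real_part (x k.1)).
  apply/ffunP => i; rewrite ffunE /=; move: (x i).
  rewrite /of_real /imag_unit /imag_part /real_part.
  case: K => /= [y|[a b]]; first by rewrite mulr0 addr0.
  by apply/eqP; rewrite eq_complex /=; apply/andP; split; apply/eqP; ring.
case=> i b; rewrite (bigD1 i) //=; apply: (@le_trans _ _ (modulus (x i))).
  rewrite -ler_sqr ?nnegrE ?modulus_ge0 //= sqr_modulus real_normK ?num_real //.
  by case: b; rewrite ?lerDr ?lerDl sqr_ge0.
by rewrite lerDl sumr_ge0 // => j _; rewrite modulus_ge0.
Qed.

Definition continuous_on_vectors (f : V -> F) :=
  scalar_continuous (fun c => f (of_coordinates c)).

Lemma continuous_coordinate (i : I) : continuous_on_vectors (fun x => x i).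
Proof.
have cp b : scalar_continuous (fun c : coordinates => of_real K (c (i, b))).
  have ci : continuous (fun c : coordinates => c (i, b)) by exact: proj_continuous.
  split; first by under eq_fun do rewrite of_realK.
  by rewrite /of_real /imag_part; case: K; exact: cst_continuous.
rewrite /continuous_on_vectors; under eq_fun do rewrite ffunE.
apply: scalar_continuousD => //; apply: scalar_continuousM => //.
exact: scalar_continuous_cst.
Qed.

(** Constraints given as equations between continuous functions cut out a closed set. In coordinates
    it is intersected with a cube, compact by Tychonoff's theorem, that still contains a preimage of
    every feasible vector. *)
Lemma extreme_value (J : Type) (g : J -> V -> F) (h : V -> R) (b : R) (x0 : V) :
    (forall k, continuous_on_vectors (g k)) ->
    continuous (fun c => h (of_coordinates c)) ->
    (forall x, (forall k, g k x = 0) -> forall i, modulus (x i) <= b) ->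
    (forall k, g k x0 = 0) ->
  exists x, (forall k, g k x = 0) /\
    forall y, (forall k, g k y = 0) -> h y <= h x.
Proof.
move=> cg ch bnd g0.
(* The coordinates of the chosen preimage are bounded by the sum of all moduli, each of which is at
   most [b]. *)
pose B := \sum_(i : I) b.
pose A := ([set c : coordinates | forall k, c k \in `[- B, B]%R] `&`
  \bigcap_(k in setT) [set c | g k (of_coordinates c) = 0])%classic.
have Apre y : (forall k, g k y = 0) -> exists2 c, A c & of_coordinates c = y.
  move=> gy; have [c cy cB] := of_coordinates_surj y.
  exists c => //; split=> [k|k _] /=; last by rewrite cy.
  rewrite in_itv /= -ler_norml; apply: le_trans (cB k) _.
  by apply: ler_sum => i _; exact: bnd.
have cA : compact A.
  have cube : compact [set c : coordinates | forall k, c k \in `[- B, B]%R]%classic.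
    apply: (@tychonoff _ (fun=> R) (fun=> `[- B, B]%classic)) => _.
    exact: segment_compact.
  rewrite /A setIC; apply: (subclosed_compact _ cube); last by move=> c [].
  apply: closedI; first by apply: closed_bigI => k _; exact: (closed_zero (cg k)).
  apply: compact_closed cube; apply: hausdorff_product => _.
  exact: Rhausdorff.
have [c0 Ac0 _] := Apre _ g0.
have [c /set_mem[_ Ac] cmax] :=
  compact_EVT_max (ex_intro _ c0 Ac0) cA (continuous_subspaceT ch).
exists (of_coordinates c); split=> [k|y /Apre[c' Ac' <-]]; first by apply: Ac.
by apply: cmax; rewrite inE.
Qed.

End ExtremeValue.

(** * Banach's theorem on symmetric multilinear forms *)

Section Banach.
Context (R : realType) (K : base_field).
Local Notation F := (scalar R K).

Definition update (T : Type) (d : nat) (z : 'I_d -> T) (j : 'I_d) (u : T) :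
    'I_d -> T :=
  fun k => if k == j then u else z k.

Lemma parallelogram (I : finType) (x y : {ffun I -> F}) :
  sqnorm (x + y) + sqnorm (x - y) = 2 * (sqnorm x + sqnorm y).
Proof. by rewrite !sqnormD sqnormN innerNr raddfN /=; ring. Qed.

(** At a maximizing pair the functional [B _ y] is extremal at [x], and [B _ x] at [y], so both are
    multiples of inner products with the same factor [B x y]. Adding them gives
    [B z (x + y) = B x y * inner (x + y) z]; at [z = u] the length [t] of [x + y] cancels. *)
Lemma merge_maximizers (I : finType) (B : {ffun I -> F} -> {ffun I -> F} -> F)
    (x y : {ffun I -> F}) :
    (forall v, exists l, forall u, B u v = inner l u) ->
    (forall u v, B u v = B v u) ->
    sqnorm x = 1 -> sqnorm y = 1 -> x != y ->
    (forall u v, sqnorm u = 1 -> sqnorm v = 1 ->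
       modulus (B u v) <= modulus (B x y)) ->
  exists t u, [/\ 0 <= t < 2, sqnorm u = 1, x + y = scalev (of_real K t) u &
                  modulus (B u u) = modulus (B x y)].
Proof.
move=> linB symB x1 y1 xy maxB.
have linBr u v w : B u (v + w) = B u v + B u w.
  by have [l lE] := linB u; rewrite symB (symB u v) (symB u w) !lE innerDr.
have [xy0|/normalize[t [u [t0 tE u1 sE]]]] := eqVneq (x + y) 0.
  (* Here [y = - x], so [u = x] changes [B] only by a sign, and [t = 0]. *)
  exists 0, x; split=> //; first by rewrite lexx ltr0n.
    by rewrite rmorph0 scalev0.
  have -> : y = - x by apply/eqP; rewrite -addr_eq0 addrC xy0.
  have [l lE] := linB x.
  by rewrite (symB x (- x)) !lE innerNr modulusN.
have t2 : t < 2.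
  (* By the parallelogram law, [t ^+ 2 = 4 - sqnorm (x - y)]. *)
  have dxy : 0 < sqnorm (x - y).
    rewrite lt_def sqnorm_ge0 andbT; apply: contraNneq xy => /sqnorm_eq0/eqP.
    by rewrite subr_eq0.
  have := parallelogram x y; rewrite x1 y1 -tE; nra.
exists t, u; split=> //; first by rewrite ltW.
have BE v w z : sqnorm v = 1 -> sqnorm w = 1 -> B v w = B x y ->
    B z w = B x y * inner v z.
  move=> v1 w1 vw; have [l lE] := linB w.
  have /extremal_functional lv : forall u', sqnorm u' = 1 ->
      modulus (inner l u') <= modulus (inner l v).
    by move=> u' u'1; rewrite -!lE vw; exact: maxB.
  by rewrite lE lv // innerZl -lE vw.
have Bs z : B z (x + y) = B x y * inner (x + y) z.
  rewrite linBr (BE y x z) // (BE x y z) // -mulrDr -innerDl.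
  by rewrite (addrC y).
have := Bs u; rewrite sE symB; have [l lE] := linB u.
rewrite lE innerZr innerZl inner_self u1 rmorph1 mulr1 -lE conjugate_of_real.
rewrite [RHS]mulrC => /mulfI -> //.
by apply/eqP => /(congr1 (@real_part R K)); rewrite of_realK raddf0; lra.
Qed.

(** Labels of the equations handed to [extreme_value]; the fixed factors are compared entry by entry
    so that every equation is scalar. *)
Variant side_condition (d n : nat) :=
  UnitSlot of 'I_d | FixedEntry of 'I_d & 'I_n.

(* Among the maximizers of [|Phi|], one for which the sum of the vectors in the
   slots of [Q] is longest has all these vectors equal: two different ones
   [x], [y] with [x + y = t u], [0 <= t < 2], could both be replaced by [u] or
   both by [- u], and one of these choices makes the sum longer. *)
Lemma banach_symmetrization (n d : nat) (Q : {set 'I_d})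
    (Phi : ('I_d -> vec R K n) -> F) (x : 'I_d -> vec R K n) (e : vec R K n) :
    (forall z j, j \in Q -> exists l, forall u, Phi (update z j u) = inner l u) ->
    (forall z i j, i \in Q -> j \in Q -> Phi (fun k => z (tperm i j k)) = Phi z) ->
    @continuous_on_vectors R K _
      (fun c : {ffun 'I_d * 'I_n -> F} => Phi (fun j => [ffun a => c (j, a)])) ->
    (forall j, sqnorm (x j) = 1) -> sqnorm e = 1 ->
  exists u, sqnorm u = 1 /\
    modulus (Phi x) <= modulus (Phi (fun j => if j \in Q then u else x j)).
Proof.
move=> linPhi symPhi cPhi x1 e1.
pose V := {ffun 'I_d * 'I_n -> F}.
pose slot (c : V) (j : 'I_d) : vec R K n := [ffun a => c (j, a)].
pose pack (z : 'I_d -> vec R K n) : V := [ffun p => z p.1 p.2].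
have packK z : slot (pack z) = z.
  by apply/funext => j; apply/ffunP => a; rewrite !ffunE.
pose feasible z := (forall j, sqnorm (z j) = 1) /\ (forall j, j \notin Q -> z j = x j).
pose g (k : side_condition d n) (c : V) : F := match k with
  | UnitSlot j => inner (slot c j) (slot c j) - 1
  (* The slots of [Q] are free: their equations read [0 = 0]. *)
  | FixedEntry j a => if j \in Q then 0 else c (j, a) - x j a end.
have cslot j a : continuous_on_vectors (fun c : V => slot c j a).
  rewrite (_ : (fun c : V => _) = (fun c => c (j, a))).
    exact: continuous_coordinate.
  by apply/funext => c; rewrite ffunE.
have cg k : continuous_on_vectors (g k).
  case: k => [j|j a] /=.
    apply: scalar_continuousD; last exact: scalar_continuous_cst.
    by apply: scalar_continuous_inner => a; exact: cslot.
  rewrite /continuous_on_vectors /=; case: (j \in Q); first exact: scalar_continuous_cst.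
  by apply: scalar_continuousD; [exact: continuous_coordinate | exact: scalar_continuous_cst].
have gP c : (forall k, g k c = 0) <-> feasible (slot c).
  split=> [gc|[c1 cx] [j|j a]].
  - split=> [j|j jQ].
      have /eqP := gc (UnitSlot n j); rewrite subr_eq0 inner_self => /eqP.
      by move=> /(congr1 (@real_part R K)); rewrite of_realK -(rmorph1 (of_real K)) of_realK.
    apply/ffunP => a; rewrite ffunE.
    by have := gc (FixedEntry j a); rewrite /g (negbTE jQ) => /eqP; rewrite subr_eq0 => /eqP.
  - by rewrite /g inner_self c1 rmorph1 subrr.
  - rewrite /g; case: ifPn => // /cx /ffunP /(_ a); rewrite ffunE => ->.
    by rewrite subrr.
have bnd c : feasible (slot c) -> forall i, modulus (c i) <= 1.
  move=> [c1 _] [j a]; rewrite -(@ler_sqr _ _ 1) ?nnegrE ?modulus_ge0 // expr1n.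
  rewrite -(c1 j) sqnormE (bigD1 a) //= ffunE lerDl sumr_ge0 // => b _.
  exact: sqr_ge0.
have feasx : feasible x by [].
have [c0 [/gP c0f c0max]] := extreme_value
  (h := fun c => modulus (Phi (slot c)) ^+ 2) (x0 := pack x) cg
  (continuous_sqr_modulus cPhi) (fun c gc => bnd c ((gP c).1 gc))
  ((gP _).2 (eq_ind_r feasible feasx (packK x))).
pose m := modulus (Phi (slot c0)).
have maxPhi z : feasible z -> modulus (Phi z) <= m.
  move=> fz; have := c0max (pack z); rewrite gP -/(slot _) packK => /(_ fz).
  by rewrite -/(slot c0) ler_sqr ?nnegrE ?modulus_ge0.
(* The extra equation, labelled [None], restricts the second maximization to the maximizers of the
   first one. It uses the squared modulus, written as a product with the conjugate, to be an
   equation in the field. *)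
pose g' k c : F := if k is Some k then g k c else
  Phi (slot c) * conjugate (Phi (slot c)) - of_real K (m ^+ 2).
have cg' k : continuous_on_vectors (g' k).
  case: k => [k|]; first exact: cg.
  apply: scalar_continuousD; last exact: scalar_continuous_cst.
  by apply: scalar_continuousM => //; apply: scalar_continuous_conjugate.
have g'P c : (forall k, g' k c = 0) <->
    feasible (slot c) /\ modulus (Phi (slot c)) = m.
  split=> [gc|[/gP gc cm] [k|]]; last first.
  - by rewrite /g' mul_conjugate cm subrr.
  - exact: gc.
  split; first by apply/gP => k; exact: (gc (Some k)).
  have /eqP := gc None; rewrite subr_eq0 mul_conjugate => /eqP.
  move=> /(congr1 (@real_part R K)); rewrite !of_realK => /eqP.
  by rewrite eqrXn2 ?modulus_ge0 // => /eqP.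
pose total (z : 'I_d -> vec R K n) : vec R K n := \sum_(j in Q) z j.
have ctotal a : continuous_on_vectors (fun c => total (slot c) a).
  rewrite (_ : (fun c => _) = (fun c => \sum_(j in Q) slot c j a)).
    by apply: scalar_continuous_sum => j _; exact: cslot.
  by apply/funext => c; rewrite sum_ffunE.
have [c [/g'P[cf cm] cmax]] := extreme_value
  (h := fun c => sqnorm (total (slot c))) (x0 := c0) cg'
  (continuous_sqnorm ctotal) (fun c gc => bnd c ((g'P c).1 gc).1)
  ((g'P c0).2 (conj c0f erefl)).
have {cmax} maxtotal z : feasible z -> modulus (Phi z) = m ->
    sqnorm (total z) <= sqnorm (total (slot c)).
  by move=> fz zm; have := cmax (pack z); rewrite g'P packK => /(_ (conj fz zm)).
move: (slot c) cf cm maxtotal => {c cg cg' bnd gP g'P ctotal c0f c0max cslot}.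
move=> z zf zm maxtotal.
have zQ i j : i \in Q -> j \in Q -> z i = z j.
  move=> iQ jQ; apply/eqP/negP => /negP zij.
  have ij : i != j by apply: contraNneq zij => ->.
  (* Freezing all slots but [i] and [j] leaves a symmetric form in two vectors, maximal at
     [(z i, z j)]. *)
  pose B u v := Phi (update (update z i u) j v).
  have fB u v : sqnorm u = 1 -> sqnorm v = 1 -> feasible (update (update z i u) j v).
    move=> u1 v1; have [z1 zx] := zf; split=> k.
      by rewrite /update; case: ifP => // _; case: ifP.
    move=> kQ; rewrite /update ifN ?ifN ?zx //; by apply: contraNneq kQ => ->.
  have BE : B (z i) (z j) = Phi z.
    congr Phi; apply/funext => k; rewrite /update.
    by case: eqP => [->//|_]; case: eqP => [->|].
  have [z1 _] := zf.
  have linB v : exists l, forall u, B u v = inner l u.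
    have [l lE] := linPhi (update z j v) i iQ; exists l => u.
    rewrite -lE; congr Phi; apply/funext => k; rewrite /update.
    by case: (eqVneq k j) => // ->; rewrite eq_sym (negbTE ij).
  have symB u v : B u v = B v u.
    rewrite /B -(symPhi _ i j iQ jQ); congr Phi; apply/funext => k; rewrite /update.
    case: tpermP => [->|->|/eqP/negbTE-> /eqP/negbTE->] //.
      by rewrite eqxx (negbTE ij) eqxx.
    by rewrite (negbTE ij) !eqxx.
  have [|t [u [/andP[t0 t2] u1 sE Bu]]] :=
      merge_maximizers linB symB (z1 i) (z1 j) zij.
    by move=> u v u1 v1; rewrite BE zm; apply: maxPhi; exact: fB.
  pose S : vec R K n := \sum_(k in Q | (k != i) && (k != j)) z k.
  have totalE u' v' : total (update (update z i u') j v') = u' + v' + S.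
    rewrite /total (bigD1 i) //= (bigD1 j) /=; last by rewrite jQ eq_sym.
    rewrite /update !eqxx (negbTE ij) addrA; congr (_ + _).
    under eq_bigl do rewrite -andbA.
    by apply: eq_bigr => k /and3P[_ /negbTE-> /negbTE->].
  have totalz : total z = scalev (of_real K t) u + S.
    rewrite -sE -totalE; congr total; apply/funext => k; rewrite /update.
    by case: eqP => [->//|_]; case: eqP => [->|].
  have le1 : sqnorm (u + u + S) <= sqnorm (scalev (of_real K t) u + S).
    by rewrite -totalE -totalz; apply: maxtotal; [exact: fB|rewrite -zm -BE].
  have le2 : sqnorm (- u - u + S) <= sqnorm (scalev (of_real K t) u + S).
    rewrite -totalE -totalz; apply: maxtotal; first by apply: fB; rewrite sqnormN.
    have [l lE] := linB (- u); have [l' lE'] := linB u.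
    rewrite -zm -BE -Bu -/(B _ _) lE innerNr -lE symB lE' innerNr.
    by rewrite modulusN -lE' modulusN.
  (* Let [rho] be the real part of [inner u S]. After division by [2 - t] and [2 + t] respectively,
     the two inequalities become [2 + t + 2 * rho <= 0] and [2 - t <= 2 * rho], which contradict
     each other for [0 <= t < 2]. *)
  move: le1 le2; rewrite !sqnormD !sqnormN sqnormZ sqr_modulus_of_real u1.
  rewrite !innerDl !innerNl !innerNr innerZl inner_self u1 !raddfD /= !raddfN /=.
  by rewrite real_partZ of_realK; nra.
(* If [Q] is empty there is no slot to take [u] from, and the given unit vector [e] serves. *)
have [j jQ|Q0] := pickP (mem Q); last first.
  exists e; split=> //; rewrite (_ : (fun j => _) = x) //.
  by apply/funext => j; have := Q0 j; rewrite /= => ->.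
have [z1 zx] := zf; exists (z j); split=> //.
rewrite (_ : (fun k => _) = z); first by rewrite zm; exact: maxPhi.
apply/funext => k; case: ifP => [kQ|/negbT/zx->//]; exact: zQ.
Qed.

End Banach.

(** * Rank one tensors, their combinations, and compactness of the symmetric family *)

Section Tensors.
Context (R : realType) (K : base_field).
Local Notation F := (scalar R K).

Lemma scalar_continuous_rank_one (D : topologicalType) (d n : nat)
    (z : D -> 'I_d -> vec R K n) (i : {ffun 'I_d -> 'I_n}) :
  (forall j a, scalar_continuous (fun x => z x j a)) ->
  scalar_continuous (fun x => rank_one (z x) i).
Proof.
move=> cz; rewrite (_ : (fun x => _) = (fun x => \prod_(j < d) z x j (i j))).
  exact: scalar_continuous_prod.
by apply/funext => x; rewrite ffunE.
Qed.

(** The vector [l] is the contraction of [T] with the conjugates of all the other factors. *)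
Lemma inner_rank_one_slot (d n : nat) (T : tensor R K d n)
    (z : 'I_d -> vec R K n) (j : 'I_d) :
  exists l, forall u, inner T (rank_one (update z j u)) = inner l u.
Proof.
exists [ffun a => \sum_(i : {ffun 'I_d -> 'I_n} | i j == a)
  T i * conjugate (\prod_(k | k != j) z k (i k))].
move=> u; rewrite /inner (partition_big (fun i : {ffun 'I_d -> 'I_n} => i j) xpredT) //=.
apply: eq_bigr => a _; rewrite ffunE mulr_suml; apply: eq_bigr => i /eqP ia.
rewrite ffunE (bigD1 j) //= {1}/update eqxx ia rmorphM /= mulrCA mulrC.
congr (_ * conjugate _ * _); apply: eq_bigr => k /negbTE kj.
by rewrite /update kj.
Qed.

(** Reindexing the multi-indices by [s] leaves [T] unchanged by symmetry, and reindexing the product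
    of the entries by [s] undoes the permutation of the factors. *)
Lemma inner_rank_one_perm (d n : nat) (T : tensor R K d n)
    (z : 'I_d -> vec R K n) (s : 'S_d) : symmetric_tensor T ->
  inner T (rank_one (fun k => z (s k))) = inner T (rank_one z).
Proof.
move=> symT; rewrite /inner.
rewrite (reindex (fun i : {ffun 'I_d -> 'I_n} => [ffun k => i (s k)])) /=.
  apply: eq_bigr => i _; rewrite symT !ffunE; congr (_ * conjugate _).
  rewrite [RHS](reindex_inj (@perm_inj _ s)) /=.
  by apply: eq_bigr => k _; rewrite ffunE.
exists (fun i : {ffun 'I_d -> 'I_n} => [ffun k => i (s^-1%g k)]) => i _;
  apply/ffunP => k; by rewrite !ffunE ?permK ?permKV.
Qed.

Lemma inner_rank_one (d n : nat) (x y : 'I_d -> vec R K n) :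
  inner (rank_one x) (rank_one y) = \prod_(j < d) inner (x j) (y j).
Proof.
rewrite /inner bigA_distr_bigA /=; apply: eq_bigr => i _.
by rewrite !ffunE rmorph_prod -big_split.
Qed.

Lemma rank_one_scale (d n : nat) (a : 'I_d -> F) (x : 'I_d -> vec R K n) :
  rank_one (fun j => scalev (a j) (x j)) = scalev (\prod_j a j) (rank_one x).
Proof.
apply/ffunP => i; rewrite !ffunE -big_split; apply: eq_bigr => j _.
by rewrite ffunE.
Qed.

Lemma sqnorm_rank_one (d n : nat) (x : 'I_d -> vec R K n) :
  (forall j, sqnorm (x j) = 1) -> sqnorm (rank_one x) = 1.
Proof.
move=> x1; rewrite /sqnorm inner_rank_one big1 => [|j _].
  by rewrite -(rmorph1 (of_real K)) of_realK.
by rewrite inner_self x1 rmorph1.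
Qed.

Section Combinations.
Context (d n r : nat).
Implicit Types (X : 'I_r -> tensor R K d n) (sigma : 'I_r -> F).

(** This turns the choice of the coefficients into a Cauchy-Schwarz problem between the vector of
    term values and [sigma]. *)
Lemma inner_combination (T : tensor R K d n) sigma X :
  inner T (combination sigma X) =
  inner [ffun k => inner T (X k)] [ffun k => sigma k].
Proof.
rewrite /inner; under eq_bigr do rewrite ffunE rmorph_sum mulr_sumr.
rewrite exchange_big; apply: eq_bigr => k _; rewrite !ffunE mulr_suml.
by apply: eq_bigr => i _; rewrite rmorphM /=; ring.
Qed.

Lemma sqnorm_combination sigma X :
  (forall k k', inner (X k) (X k') = (k == k')%:R) ->
  sqnorm (combination sigma X) = \sum_k modulus (sigma k) ^+ 2.
Proof.
move=> oX; rewrite /sqnorm inner_combination /inner raddf_sum.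
apply: eq_bigr => k _; rewrite !ffunE -[RHS](of_realK K) -mul_conjugate.
congr (real_part (_ * _)).
rewrite -[LHS]/(inner (combination sigma X) (X k)) inner_conjugate.
have oXE k1 k2 : \sum_i X k1 i * conjugate (X k2 i) = (k1 == k2)%:R := oX k1 k2.
rewrite inner_combination /inner (bigD1 k) //= big1 => [|l lk].
  by rewrite !ffunE oXE eqxx mul1r addr0 conjugateK.
by rewrite !ffunE oXE eq_sym (negbTE lk) mul0r.
Qed.

End Combinations.

Variant symmetric_constraint (r n : nat) :=
  | Orthonormal of 'I_r & 'I_r
  | UnitVector of 'I_r
  | UnitCoefficients.

(** The parameters [w], [v] and [sigma] are packed into a single vector; the constraints are
    equations in its entries and their conjugates, and bound every entry by 1. Non-emptiness is
    assumed because no orthonormal family [w] exists when [r] exceeds [n]. *)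
Lemma symmetric_values_has_max (d n r : nat) (P : {set 'I_d})
    (T : tensor R K d n) :
  (exists m, symmetric_values r P T m) ->
  exists M, is_max (symmetric_values r P T) M.
Proof.
move=> [_ [w0 [v0 [sigma0 [ortho0 unit0 coef0 _]]]]].
pose V := {ffun ('I_r * 'I_n) + ('I_r * 'I_n) + 'I_r -> F}.
pose w (c : V) k : vec R K n := [ffun a => c (inl (inl (k, a)))].
pose v (c : V) k : vec R K n := [ffun a => c (inl (inr (k, a)))].
pose s (c : V) k : F := c (inr k).
pose pack (w v : 'I_r -> vec R K n) (s : 'I_r -> F) : V := [ffun i => match i with
  | inl (inl p) => w p.1 p.2 | inl (inr p) => v p.1 p.2 | inr k => s k end].
have wK w' v' s' : w (pack w' v' s') = w'.
  by apply/funext => k; apply/ffunP => a; rewrite !ffunE.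
have vK w' v' s' : v (pack w' v' s') = v'.
  by apply/funext => k; apply/ffunP => a; rewrite !ffunE.
have sK w' v' s' : s (pack w' v' s') = s'.
  by apply/funext => k; rewrite /s !ffunE.
have cw k a : continuous_on_vectors (fun c : V => w c k a).
  rewrite (_ : (fun c : V => _) = (fun c => c (inl (inl (k, a))))).
    exact: continuous_coordinate.
  by apply/funext => c; rewrite ffunE.
have cv k a : continuous_on_vectors (fun c : V => v c k a).
  rewrite (_ : (fun c : V => _) = (fun c => c (inl (inr (k, a))))).
    exact: continuous_coordinate.
  by apply/funext => c; rewrite ffunE.
have cs k : continuous_on_vectors (fun c : V => s c k).
  exact: continuous_coordinate.
pose value (c : V) := inner T
  (combination (s c) (fun k => two_powers d #|P| (w c k) (v c k))).
have cvalue : continuous_on_vectors value.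
  apply: scalar_continuous_inner => i; first exact: scalar_continuous_cst.
  set f := (X in scalar_continuous X).
  rewrite (_ : f = fun c => \sum_(k < r) s (of_coordinates K c) k *
      two_powers d #|P| (w (of_coordinates K c) k) (v (of_coordinates K c) k) i).
    apply: scalar_continuous_sum => k _; apply: scalar_continuousM; first exact: cs.
    apply: scalar_continuous_rank_one => j a; case: (j < #|P|)%N; first exact: cw.
    exact: cv.
  by apply/funext => c; rewrite /f ffunE.
pose g (k : symmetric_constraint r n) (c : V) : F := match k with
  | Orthonormal k k' => inner (w c k) (w c k') - (k == k')%:R
  | UnitVector k => inner (v c k) (v c k) - 1
  | UnitCoefficients => \sum_k s c k * conjugate (s c k) - 1 end.
have cg k : continuous_on_vectors (g k).
  case: k => [k k'|k|]; apply: scalar_continuousD; try exact: scalar_continuous_cst.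
  - by apply: scalar_continuous_inner => a; exact: cw.
  - by apply: scalar_continuous_inner => a; exact: cv.
  - apply: scalar_continuous_sum => k _; apply: scalar_continuousM; first exact: cs.
    exact: (scalar_continuous_conjugate (cs k)).
pose feasible (w v : 'I_r -> vec R K n) (s : 'I_r -> F) :=
  [/\ forall k k' : 'I_r, inner (w k) (w k') = (k == k')%:R,
      forall k : 'I_r, norm (v k) = 1 & \sum_(k < r) modulus (s k) ^+ 2 = 1].
have subr1P (a : R) : of_real K a - 1 = 0 <-> a = 1.
  split=> [/eqP|->]; last by rewrite rmorph1 subrr.
  rewrite subr_eq0 => /eqP/(congr1 (@real_part R K)).
  by rewrite of_realK -(rmorph1 (of_real K)) of_realK.
have coefE (t : 'I_r -> F) :
    \sum_k t k * conjugate (t k) = of_real K (\sum_k modulus (t k) ^+ 2).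
  by rewrite rmorph_sum; apply: eq_bigr => k _; rewrite mul_conjugate.
have gP c : (forall k, g k c = 0) <-> feasible (w c) (v c) (s c).
  split=> [gc|[ortho unit coef]]; last first.
    case=> [k k'|k|] /=; first by rewrite ortho subrr.
      by rewrite inner_self; apply/subr1P/norm_eq1.
    by rewrite coefE; apply/subr1P.
  split=> [k k'|k|].
  - by have /eqP := gc (Orthonormal n k k'); rewrite subr_eq0 => /eqP.
  - by apply/norm_eq1/subr1P; rewrite -inner_self; exact: (gc (UnitVector n k)).
  - by apply/subr1P; rewrite -coefE; exact: (gc (UnitCoefficients r n)).
have bnd c : (forall k, g k c = 0) -> forall i, modulus (c i) <= 1.
  have le1 (I : finType) (t : I -> F) i :
      \sum_i modulus (t i) ^+ 2 = 1 -> modulus (t i) <= 1.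
    move=> t1; rewrite -(@ler_sqr _ _ 1) ?nnegrE ?modulus_ge0 // expr1n -t1.
    by rewrite (bigD1 i) //= lerDl sumr_ge0 // => j _; exact: sqr_ge0.
  move=> /gP[ortho unit coef] [[[k a]|[k a]]|k].
  - have := @le1 _ (w c k) a; rewrite ffunE; apply; rewrite -sqnormE.
    by apply/subr1P; rewrite -inner_self ortho eqxx subrr.
  - by have := @le1 _ (v c k) a; rewrite ffunE; apply; rewrite -sqnormE; apply/norm_eq1.
  - exact: (@le1 _ (s c)).
have g0 k : g k (pack w0 v0 sigma0) = 0.
  by move: k; apply/gP; rewrite wK vK sK.
have [c [/gP[ortho unit coef] cmax]] := extreme_value
  (h := fun c => modulus (value c) ^+ 2) (x0 := pack w0 v0 sigma0) cg
  (continuous_sqr_modulus cvalue) bnd g0.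
exists (modulus (value c)); split; first by exists (w c), (v c), (s c).
move=> _ [w' [v' [s' [ortho' unit' coef' ->]]]].
have := cmax (pack w' v' s'); rewrite gP /value wK vK sK ler_sqr ?nnegrE ?modulus_ge0 //.
by apply.
Qed.

(** The indicators of [P] and of the first [#|P|] positions, as Boolean tuples, have equally many
    entries of each value, hence are permutations of each other. *)
Lemma tensor_perm_set (d : nat) (P : {set 'I_d}) :
  exists s : 'S_d, forall j, (s j < #|P|)%N = (j \in P).
Proof.
pose t1 : d.-tuple bool := [tuple (j \in P) | j < d].
pose t2 : d.-tuple bool := [tuple (j < #|P|)%N | j < d].
have /tuple_permP[s sE] : perm_eq t2 t1.
  have cE (p : pred 'I_d) : count id [tuple p j | j < d] = #|p|.
    by rewrite count_map cardE -size_filter val_ord_tuple enumT.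
  have c1 : count id t1 = #|P| by rewrite cE; exact: eq_card.
  have Pd : (#|P| <= d)%N by rewrite -[X in (_ <= X)%N]card_ord max_card.
  have c2 : count id t2 = #|P|.
    rewrite cE; move: #|P| Pd => p pd; rewrite -sum1_card.
    by rewrite (big_ord_narrow pd) sum1_card card_ord.
  have cC (t : d.-tuple bool) : count negb t = (d - count id t)%N.
    by rewrite -[X in (X - _)%N](size_tuple t) -(count_predC id t) addKn.
  have c3 : count negb t2 = count negb t1 by rewrite !cC c1 c2.
  apply/allP => -[] _ /=; apply/eqP.
    by rewrite !(eq_count (a2 := id)) ?c1 ?c2 // => -[].
  by rewrite !(eq_count (a2 := negb)) //; case.
have tE : t2 = [tuple tnth t1 (s i) | i < d] by exact: val_inj.
(* The permutation [s] carries the initial positions into [P], so its inverse is the one asked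
   for. *)
exists (s^-1)%g => j; have := congr1 (fun t => tnth t (s^-1%g j)) tE.
by rewrite !tnth_mktuple permKV.
Qed.

End Tensors.

(** * Orthogonality in the plane *)

Section Plane.
Context (R : realType) (K : base_field).
Local Notation F := (scalar R K).
Local Notation V2 := {ffun 'I_2 -> F}.
Implicit Types (a b x : V2).

Definition perp x : V2 :=
  [ffun i => if i == ord0 then - conjugate (x ord_max) else conjugate (x ord0)].

Lemma inner2E x y :
  inner x y = x ord0 * conjugate (y ord0) + x ord_max * conjugate (y ord_max).
Proof.
rewrite /inner big_ord_recr big_ord_recr big_ord0 /= add0r.
by congr (_ * conjugate _ + _); congr (_ _); apply/val_inj.
Qed.

Lemma perp0 x : perp x ord0 = - conjugate (x ord_max).
Proof. by rewrite ffunE. Qed.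

Lemma perp1 x : perp x ord_max = conjugate (x ord0).
Proof. by rewrite ffunE. Qed.

Lemma ord2P (Q : 'I_2 -> Prop) : Q ord0 -> Q ord_max -> forall i, Q i.
Proof.
move=> Q0 Q1 [[|[|//]] i2]; first by rewrite (_ : Ordinal i2 = ord0) //; exact: val_inj.
by rewrite (_ : Ordinal i2 = ord_max) //; exact: val_inj.
Qed.

Lemma perpK x : perp (perp x) = - x.
Proof.
apply/ffunP; elim/ord2P; rewrite [RHS]ffunE !(perp0, perp1).
  by rewrite conjugateK.
by rewrite rmorphN /= conjugateK.
Qed.

Lemma inner_perp x y : inner (perp x) (perp y) = conjugate (inner x y).
Proof.
by rewrite !inner2E !perp0 !perp1 !(rmorphD, rmorphM, rmorphN) /= !conjugateK; ring.
Qed.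

Lemma inner_perp_self x : inner x (perp x) = 0.
Proof. by rewrite inner2E perp0 perp1 rmorphN /= !conjugateK; ring. Qed.

(** The outer conjugation compensates the conjugate linearity of [perp], so that the result is again
    a functional of the form [inner _ u]. *)
Lemma conjugate_inner_perp l u : conjugate (inner l (perp u)) = inner (- perp l) u.
Proof.
by rewrite -inner_perp perpK innerNl innerNr.
Qed.

Lemma sqnorm_perp x : sqnorm (perp x) = sqnorm x.
Proof. by rewrite /sqnorm inner_perp real_part_conjugate. Qed.

(** The vectors [x] and [perp x] form an orthonormal basis. In coordinates, each entry of the
    difference of the two sides is a combination of [1 - inner x x] and [inner b x]. *)
Lemma orthogonal_perp x b : sqnorm x = 1 -> inner b x = 0 ->
  b = scalev (inner b (perp x)) (perp x).
Proof.
move=> x1 bx; have xx : inner x x = 1 by rewrite inner_self x1 rmorph1.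
move: bx xx; rewrite !inner2E => bx xx.
apply/ffunP; elim/ord2P; rewrite ffunE ?perp0 ?perp1 rmorphN /= !conjugateK;
  apply/eqP; rewrite -subr_eq0; apply/eqP.
- transitivity (b ord0 * (1 - (x ord0 * conjugate (x ord0) +
      x ord_max * conjugate (x ord_max)))
    + x ord0 * (b ord0 * conjugate (x ord0) + b ord_max * conjugate (x ord_max))).
    by ring.
  by rewrite xx bx subrr !mulr0 addr0.
- transitivity (b ord_max * (1 - (x ord0 * conjugate (x ord0) +
      x ord_max * conjugate (x ord_max)))
    + x ord_max * (b ord0 * conjugate (x ord0) + b ord_max * conjugate (x ord_max))).
    by ring.
  by rewrite xx bx subrr !mulr0 addr0.
Qed.

Definition basis_vector : V2 := [ffun i => (i == ord0)%:R].

Lemma sqnorm_basis_vector : sqnorm basis_vector = 1.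
Proof.
rewrite /sqnorm inner2E !ffunE /= mulr1n mulr0n rmorph1 mulr1 mul0r addr0.
by rewrite -(rmorph1 (of_real K)) of_realK.
Qed.

Lemma unit_multiple a : exists x c, sqnorm x = 1 /\ a = scalev c x.
Proof.
have [->|/normalize[t [u [_ _ u1 ->]]]] := eqVneq a 0; last by exists u, (of_real K t).
by exists basis_vector, 0; rewrite scalev0 sqnorm_basis_vector.
Qed.

(** The direction [x] comes from [a] unless [a = 0]; then it is [perp u] for a direction [u] of [b],
    and [perp (perp u) = - u] accounts for the sign of [e]. Both vectors may vanish. *)
Lemma orthogonal_pair a b : inner a b = 0 ->
  exists x c e, [/\ sqnorm x = 1, a = scalev c x & b = scalev e (perp x)].
Proof.
move=> ab; have [a0|/normalize[t [x [t0 _ x1 aE]]]] := eqVneq a 0.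
  have [u [c [u1 bE]]] := unit_multiple b.
  exists (perp u), 0, (- c); rewrite sqnorm_perp perpK u1 a0 scalev0; split=> //.
  by rewrite bE; apply/ffunP => i; rewrite !ffunE mulrNN.
exists x, (of_real K t), (inner b (perp x)); split=> //.
apply: orthogonal_perp => //; rewrite inner_conjugate; apply/eqP.
rewrite -(inj_eq (inv_inj (@conjugateK R K))) conjugateK rmorph0; apply/eqP.
move: ab; rewrite aE innerZl => /eqP; rewrite mulf_eq0 => /orP[/eqP t00|/eqP //].
by move: t0; rewrite -(of_realK K t) t00 raddf0 ltxx.
Qed.

End Plane.

(** * Symmetrization of the terms and comparison of the two sets of values *)

Section Symmetrization.
Context (R : realType) (K : base_field) (d : nat) (T : tensor R K d 2).
Context (symT : symmetric_tensor T) (P : {set 'I_d}).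
Local Notation F := (scalar R K).
Local Notation V2 := (vec R K 2).
Implicit Types (x y v : 'I_d -> V2) (w : V2).

Definition mix (Q : {set 'I_d}) (x y : 'I_d -> V2) : 'I_d -> V2 :=
  fun j => if j \in Q then x j else y j.

Local Notation form z := (inner T (rank_one z)).

(** A transposition of two indices of [Q] fixes every index outside [Q], so it permutes the factors
    of the whole mixture. *)
Lemma mix_perm (Q : {set 'I_d}) x y i j : i \in Q -> j \in Q ->
  form (mix Q (fun k => x (tperm i j k)) (fun k => y (tperm i j k))) =
  form (mix Q x y).
Proof.
move=> iQ jQ; rewrite -(inner_rank_one_perm (mix Q x y) (tperm i j) symT).
congr (form _); apply/funext => k; rewrite /mix.
by case: tpermP => [->|->|//]; rewrite iQ jQ.
Qed.

(** Banach's theorem in the slots of the complement of [P], with the factors in [P] held fixed. *)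
Lemma symmetrize_outside x : (forall j, sqnorm (x j) = 1) ->
  exists v : V2, sqnorm v = 1 /\
    modulus (form x) <= modulus (form (mix P x (fun=> v))).
Proof.
move=> x1.
have [|||v [v1 le]] := banach_symmetrization (Q := ~: P)
    (Phi := fun z => form z) _ _ _ x1 (sqnorm_basis_vector R K).
- by move=> z j _; exact: inner_rank_one_slot.
- by move=> z i j _ _; exact: inner_rank_one_perm.
- apply: scalar_continuous_inner => i; first exact: scalar_continuous_cst.
  apply: scalar_continuous_rank_one => j a.
  rewrite (_ : (fun c => _) = (fun c => of_coordinates K c (j, a))).
    exact: continuous_coordinate.
  by apply/funext => c; rewrite ffunE.
exists v; split=> //; rewrite (_ : mix _ _ _ = fun j => if j \in ~: P then v else x j) //.
by apply/funext => j; rewrite /mix finset.in_setC; case: (j \in P).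
Qed.

Lemma update_mix_in x y j u : j \in P ->
  mix P (update x j u) y = update (mix P x y) j u.
Proof.
move=> jP; apply/funext => k; rewrite /mix /update.
by case: (eqVneq k j) => // ->; rewrite jP.
Qed.

(* In the plane the second term is determined by the first one, up to phases:
   its factors in [P] are the [perp (x j)]. As [perp] is conjugate linear, both
   terms depend on [x] through multilinear forms of the same kind, once the
   second form is conjugated. *)
Lemma symmetrize_inside x (v v' : V2) : (forall j, sqnorm (x j) = 1) ->
  exists w, sqnorm w = 1 /\
    modulus (form (mix P x (fun=> v))) ^+ 2 +
    modulus (form (mix P (fun j => perp (x j)) (fun=> v'))) ^+ 2 <=
    modulus (form (mix P (fun=> w) (fun=> v))) ^+ 2 +
    modulus (form (mix P (fun=> perp w) (fun=> v'))) ^+ 2.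
Proof.
move=> x1.
pose A z := form (mix P z (fun=> v)).
pose B z := form (mix P (fun j => perp (z j)) (fun=> v')).
(* The squared norm of [G z] is the sum to be increased. *)
pose G z : V2 := [ffun k => if k == ord0 then A z else conjugate (B z)].
have GE z : sqnorm (G z) = modulus (A z) ^+ 2 + modulus (B z) ^+ 2.
  rewrite sqnormE big_ord_recr big_ord_recr big_ord0 /= add0r !ffunE /=.
  by rewrite modulus_conjugate.
have [|||w [w1 le]] := banach_symmetrization (Q := P)
    (Phi := fun z => inner (G z) (G x)) _ _ _ x1 (sqnorm_basis_vector R K).
- move=> z j jP.
  have [l lE] := inner_rank_one_slot T (mix P z (fun=> v)) j.
  have [l' l'E] := inner_rank_one_slot T (mix P (fun k => perp (z k)) (fun=> v')) j.
  exists (scalev (conjugate (G x ord0)) l +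
          scalev (conjugate (G x ord_max)) (- perp l')) => u.
  rewrite innerDl !innerZl inner2E [G (update z j u) _]ffunE.
  rewrite [G (update z j u) ord_max]ffunE /= -conjugate_inner_perp.
  rewrite /A /B update_mix_in // lE.
  rewrite (_ : (fun k => perp (update z j u k)) = update (fun k => perp (z k)) j (perp u)).
    by rewrite update_mix_in // l'E; ring.
  by apply/funext => k; rewrite /update; case: ifP.
- move=> z i j iP jP; congr (inner _ _); apply/ffunP => k; rewrite !ffunE.
  have -> : A (fun k => z (tperm i j k)) = A z := mix_perm z (fun=> v) iP jP.
  have -> // : B (fun k => z (tperm i j k)) = B z.
  exact: (mix_perm (fun k => perp (z k)) (fun=> v') iP jP).
- pose slot (c : coordinates R ('I_d * 'I_2)%type) (j : 'I_d) : V2 :=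
    [ffun a => of_coordinates K c (j, a)].
  have cslot j a : scalar_continuous (fun c => slot c j a).
    rewrite (_ : (fun c => _) = (fun c => of_coordinates K c (j, a))).
      exact: continuous_coordinate.
    by apply/funext => c; rewrite ffunE.
  have cform (z : _ -> 'I_d -> V2) :
      (forall j a, scalar_continuous (fun c => z c j a)) ->
      scalar_continuous (fun c : coordinates R ('I_d * 'I_2)%type => form (z c)).
    move=> cz; apply: scalar_continuous_inner => i; first exact: scalar_continuous_cst.
    exact: scalar_continuous_rank_one.
  have cA : scalar_continuous (fun c => A (slot c)).
    apply: cform => j a; rewrite /mix; case: (j \in P); first exact: cslot.
    exact: scalar_continuous_cst.
  have cB : scalar_continuous (fun c => B (slot c)).
    apply: cform => j a; rewrite /mix; case: (j \in P); last exact: scalar_continuous_cst.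
    rewrite (_ : (fun c => _) = (fun c => if a == ord0
      then - conjugate (slot c j ord_max) else conjugate (slot c j ord0))).
      case: (a == ord0); last exact: scalar_continuous_conjugate.
      by apply: scalar_continuousN; exact: scalar_continuous_conjugate.
    by apply/funext => c; rewrite ffunE.
  apply: scalar_continuous_inner => k; last exact: scalar_continuous_cst.
  rewrite (_ : (fun c => _) =
    (fun c => if k == ord0 then A (slot c) else conjugate (B (slot c)))).
    by case: (k == ord0); [exact: cA | exact: (scalar_continuous_conjugate cB)].
  by apply/funext => c; rewrite ffunE.
set z := (fun j => _) in le.
have zA : A z = form (mix P (fun=> w) (fun=> v)).
  by congr (form _); apply/funext => j; rewrite /mix /z; case: (j \in P).
have zB : B z = form (mix P (fun=> perp w) (fun=> v')).
  by congr (form _); apply/funext => j; rewrite /mix /z; case: (j \in P).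
exists w; split=> //; rewrite -zA -zB -/(A x) -/(B x) -!GE.
(* At [x] the scalar form equals [sqnorm (G x)]. Hence [sqnorm (G x)] is at most the modulus of
   [inner (G z) (G x)], and Cauchy-Schwarz bounds the latter by the product of the norms, so [G z]
   is at least as long as [G x]. *)
have := cauchy_schwarz (G z) (G x).
have : sqnorm (G x) <= modulus (inner (G z) (G x)).
  by apply: le_trans le; rewrite inner_self modulus_of_real ?sqnorm_ge0.
have := sqnorm_ge0 (G z); have := sqnorm_ge0 (G x).
by have := modulus_ge0 (inner (G z) (G x)); nra.
Qed.

Lemma form_two_powers (w v : V2) :
  inner T (two_powers d #|P| w v) = form (mix P (fun=> w) (fun=> v)).
Proof.
have [s sP] := tensor_perm_set P.
rewrite -[LHS](inner_rank_one_perm (fun j => if (j < #|P|)%N then w else v) s symT).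
by congr (form _); apply/funext => j; rewrite /mix sP.
Qed.

(** Inner products of rank one tensors are products over the factors, so a single vanishing factor,
    at [j0], suffices. *)
Lemma rank_one_orthonormal (r : nat) (x : 'I_r -> 'I_d -> V2) (j0 : 'I_d) :
  (forall k j, sqnorm (x k j) = 1) ->
  (forall k k', k != k' -> inner (x k j0) (x k' j0) = 0) ->
  forall k k', inner (rank_one (x k)) (rank_one (x k')) = (k == k')%:R.
Proof.
move=> x1 xo k k'; have [->|kk'] := eqVneq k k'.
  by rewrite inner_self sqnorm_rank_one ?rmorph1.
by rewrite inner_rank_one (bigD1 j0) //= xo // mul0r.
Qed.

(** The competitor carries the vectors [w k] at the positions of [P] rather than at the initial
    ones; the symmetry of [T] keeps the value, and an index in [P] makes the terms orthonormal, so
    its norm is 1. *)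
Lemma symmetric_values_subset (m : R) : P != finset.set0 ->
  symmetric_values 2 P T m -> PCON_values 2 P T m.
Proof.
move=> /set0Pn[j0 j0P] [w [v [sigma [ow v1 sigma1 ->]]]].
pose x k := mix P (fun=> w k) (fun=> v k).
have x1 k j : sqnorm (x k j) = 1.
  rewrite /x /mix; case: (j \in P); last exact/norm_eq1.
  by rewrite /sqnorm ow eqxx -(rmorph1 (of_real K)) of_realK.
have xo k k' j : j \in P -> inner (x k j) (x k' j) = (k == k')%:R.
  by move=> jP; rewrite /x /mix jP ow.
exists (combination sigma (fun k => rank_one (x k))).
  split; first exists sigma, x.
    by split=> // k k' /negbTE kk' j jP; rewrite xo // kk'.
  apply/norm_le1; rewrite sqnorm_combination ?sigma1 //.
  by apply: (rank_one_orthonormal (j0 := j0)) => // k k' /negbTE kk'; rewrite xo // kk'.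
rewrite !inner_combination; congr (modulus (inner _ _)).
by apply/ffunP => k; rewrite !ffunE -[LHS]/(form (x k)) -form_two_powers.
Qed.

(** Every factor is a multiple of a unit vector, and the multipliers are absorbed into the
    coefficients; vanishing factors in [P] receive directions that keep the pair orthogonal. The
    unit terms are orthonormal, so the new coefficients have square sum at most 1 and Cauchy-Schwarz
    bounds the value. *)
Lemma PCON_unit_terms (Y : tensor R K d 2) : P != finset.set0 ->
  PCON 2 P Y -> norm Y <= 1 ->
  exists x x', [/\ forall j, sqnorm (x j) = 1, forall j, sqnorm (x' j) = 1,
    forall j, j \in P -> x' j = perp (x j) &
    modulus (inner T Y) ^+ 2 <= modulus (form x) ^+ 2 + modulus (form x') ^+ 2].
Proof.
move=> /set0Pn[j0 j0P] [sigma [v [ov ->]]] /norm_le1.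
pose factors j (q : (V2 * V2) * (F * F)) :=
  [/\ sqnorm q.1.1 = 1, sqnorm q.1.2 = 1, v ord0 j = scalev q.2.1 q.1.1,
      v ord_max j = scalev q.2.2 q.1.2 & j \in P -> q.1.2 = perp q.1.1].
have /choice[f fP] j : exists q, factors j q.
  have [jP|jP] := boolP (j \in P).
    have [|x [c [e [x1 ax bx]]]] := @orthogonal_pair R K (v ord0 j) (v ord_max j).
      exact: ov.
    by exists (x, perp x, (c, e)); split=> //=; rewrite sqnorm_perp.
  have [x [c [x1 ax]]] := unit_multiple (v ord0 j).
  have [y [e [y1 bx]]] := unit_multiple (v ord_max j).
  by exists (x, y, (c, e)); split=> //=; move/negP: jP.
pose x k j := if k == ord0 :> 'I_2 then (f j).1.1 else (f j).1.2.
pose c k j := if k == ord0 :> 'I_2 then (f j).2.1 else (f j).2.2.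
have vE k j : v k j = scalev (c k j) (x k j).
  by move: k; apply: ord2P; case: (fP j).
have x1 k j : sqnorm (x k j) = 1.
  by move: k; apply: ord2P; case: (fP j).
have xP j : j \in P -> x ord_max j = perp (x ord0 j) by case: (fP j).
have xo : forall k k', k != k' -> inner (x k j0) (x k' j0) = 0.
  apply: ord2P; apply: ord2P => // _; rewrite xP //; first exact: inner_perp_self.
  by rewrite inner_conjugate inner_perp_self rmorph0.
have -> : combination sigma (fun k => rank_one (v k)) =
    combination (fun k => sigma k * \prod_j c k j) (fun k => rank_one (x k)).
  apply/ffunP => i; rewrite !ffunE; apply: eq_bigr => k _.
  rewrite -mulrA; congr (_ * _).
  rewrite (_ : v k = fun j => scalev (c k j) (x k j)); last exact/funext.
  by rewrite rank_one_scale ffunE.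
set tau := fun k => _; rewrite sqnorm_combination => [tau1|]; last first.
  exact: (rank_one_orthonormal (j0 := j0)).
exists (x ord0), (x ord_max); split=> //.
rewrite inner_combination; apply: le_trans (cauchy_schwarz _ _) _.
rewrite !sqnormE; have s1 : \sum_i modulus ([ffun k => tau k] i) ^+ 2 <= 1.
  by under eq_bigr do rewrite ffunE.
apply: (@le_trans _ _ (\sum_i modulus ([ffun k => inner T (rank_one (x k))] i) ^+ 2)).
  by rewrite ler_piMr // sumr_ge0 // => i _; exact: sqr_ge0.
rewrite big_ord_recr big_ord_recr big_ord0 /= add0r !ffunE.
by rewrite lexx.
Qed.

(** The coefficients are a unit vector along the vector [t] of the two term values, which is the
    equality case of Cauchy-Schwarz; if [t = 0], any unit vector does. *)
Lemma symmetric_value_of (w v v' : V2) :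
  sqnorm w = 1 -> sqnorm v = 1 -> sqnorm v' = 1 ->
  exists2 m, symmetric_values 2 P T m & m ^+ 2 =
    modulus (form (mix P (fun=> w) (fun=> v))) ^+ 2 +
    modulus (form (mix P (fun=> perp w) (fun=> v'))) ^+ 2.
Proof.
move=> w1 v1 v'1.
pose W (k : 'I_2) := if k == ord0 then w else perp w.
pose U (k : 'I_2) := if k == ord0 then v else v'.
pose t : V2 := [ffun k => inner T (two_powers d #|P| (W k) (U k))].
have [u [c [u1 tE]]] := unit_multiple t.
exists (modulus (inner T (combination (fun k => u k)
    (fun k => two_powers d #|P| (W k) (U k))))).
  exists W, U, (fun k => u k); split=> //; last by rewrite -sqnormE.
    have ww : inner w w = 1 by rewrite inner_self w1 rmorph1.
    apply: ord2P; apply: ord2P; rewrite /W /= ?inner_perp ?ww ?rmorph1 //.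
      exact: inner_perp_self.
    by rewrite inner_conjugate inner_perp_self rmorph0.
  by move=> k; apply/norm_eq1; rewrite /U; case: ifP.
rewrite inner_combination -/t; have -> : [ffun k => u k] = u.
  by apply/ffunP => k; rewrite ffunE.
rewrite tE innerZl inner_self u1 rmorph1 mulr1.
rewrite -!form_two_powers; transitivity (sqnorm t).
  by rewrite tE sqnormZ u1 mulr1.
by rewrite sqnormE big_ord_recr big_ord_recr big_ord0 /= add0r !ffunE.
Qed.

(** The factors outside [P] are not linked between the two terms and are made equal in each
    separately. Those inside [P] are then changed in both terms at once, with [v] and [v'] fixed. *)
Lemma PCON_values_le (m : R) : P != finset.set0 -> PCON_values 2 P T m ->
  exists2 m', symmetric_values 2 P T m' & m <= m'.
Proof.
move=> P0 [Y [pY nY] <-].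
have [x [x' [x1 x'1 xP leY]]] := PCON_unit_terms P0 pY nY.
have [v [v1 lev]] := symmetrize_outside x1.
have [v' [v'1 lev']] := symmetrize_outside x'1.
have [w [w1 lew]] := symmetrize_inside v v' x1.
have [m' sm' m'E] := symmetric_value_of w1 v1 v'1.
exists m' => //; have m'0 : 0 <= m'.
  by move: sm' => [? [? [? [_ _ _ ->]]]]; exact: modulus_ge0.
rewrite -ler_sqr ?nnegrE ?modulus_ge0 // m'E; apply: le_trans lew.
have xE : mix P x' (fun=> v') = mix P (fun j => perp (x j)) (fun=> v').
  by apply/funext => j; rewrite /mix; case: ifP => // /xP.
rewrite -xE; apply: le_trans leY _.
by apply: lerD; rewrite ler_sqr ?nnegrE ?modulus_ge0.
Qed.

End Symmetrization.

Theorem theorem4p9 (R : realType) (K : base_field) (d : nat)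
    (T : tensor R K d 2) (hT : symmetric_tensor T)
    (P : {set 'I_d}) (hP : P != finset.set0) :
  exists M : R, is_max (PCON_values 2 P T) M /\ is_max (symmetric_values 2 P T) M.
Proof.
have e1 := sqnorm_basis_vector R K.
(* The basis vector only witnesses that the set of symmetric values is non-empty. *)
have [m0 m0P _] := symmetric_value_of hT P e1 e1 e1.
have [M [MP Mmax]] := symmetric_values_has_max (ex_intro _ m0 m0P).
(* The symmetric values form a subset that dominates the larger set, so its maximum is the maximum
   of both. *)
exists M; split=> //; split; first exact: symmetric_values_subset.
move=> m /(PCON_values_le hT hP)[m' m'P mm'].
exact: le_trans mm' (Mmax _ m'P).
Qed.
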